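(* For every positive integer $b$, Angel wins the fractional $b$-Devil game on the wedge digraph $W^{24b}$, and hence Angel also wins the $b$-biased Angel-Devil game on $W^{24b}$.
   Context: $W^n$ is the digraph whose vertices are nonnegative integer $n$-tuples, with an edge $x\to y$ iff $y$ is obtained from $x$ by increasing one coordinate by $1$, rooted at the zero tuple. The fractional $p$-Devil game on a rooted digraph: each vertex has a damage in $[0,1]$, initially $0$; Angel starts at the root; players alternate, Angel first; Angel moves to an out-neighbor of his current vertex whose damage is less than $1$; Devil on his turn increases damages on a finite set of vertices by total amount at most $p$. The $b$-biased Angel-Devil game is the same except vertices are burned or unburned, Angel may only move to unburned vertices, and Devil burns at most $b$ vertices per turn. In both, Devil wins if Angel is ever unable to move; Angel wins if he can move forever. *)

(* Defs.v *)
From HB Require Import structures.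
From mathcomp Require Import all_boot all_order all_algebra.
From mathcomp Require Import finmap reals.
Set Implicit Arguments.
Unset Strict Implicit.
Unset Printing Implicit Defensive.
Import Order.TTheory GRing.Theory Num.Theory.

Record rootedDigraph := RootedDigraph {
  vertex : choiceType;
  edge : rel vertex;
  root : vertex
}.

Definition wedge (n : nat) : rootedDigraph :=
  @RootedDigraph {ffun 'I_n -> nat}
    (fun x y => [exists i : 'I_n, y == [ffun j => x j + (j == i)]])
    [ffun => 0].

(* What the fractional and the biased games have in common: Devil's legal
   turns transform a board (the damages, resp. the burned vertices), and the
   board determines which vertices Angel may enter. *)
Record devilRules (V : Type) := DevilRules {
  board : Type;
  board0 : board;
  devil_turn : board -> board -> Prop;
  enterable : board -> pred V
}.

(* Angel's (k+1)st move may depend on the boards B 0, ..., B k he has seen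
   (B i is the board after i turns of Devil). His own earlier moves need not
   be recorded: they are the values of the strategy on shorter histories. *)
Definition angel_strategy (G : rootedDigraph) (D : devilRules (vertex G)) :=
  seq (board D) -> vertex G.

Definition angel_pos (G : rootedDigraph) (D : devilRules (vertex G))
    (sigma : angel_strategy D) (B : nat -> board D) (k : nat) : vertex G :=
  if k is k'.+1 then sigma (mkseq B k'.+1) else root G.

Definition devil_play (V : Type) (D : devilRules V) (B : nat -> board D) : Prop :=
  B 0 = board0 D /\ forall k, devil_turn (B k) (B k.+1).

(* Devil may always pass in the games below, so quantifying over infinite
   sequences of turns covers every finite one. *)
Definition angel_wins (G : rootedDigraph) (D : devilRules (vertex G)) : Prop :=
  exists sigma : angel_strategy D, forall B, devil_play B -> forall k,
    edge (angel_pos sigma B k) (angel_pos sigma B k.+1) /\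
    enterable (B k) (angel_pos sigma B k.+1).

Local Open Scope ring_scope.
Local Open Scope fset_scope.

Definition fractional_turn (R : realType) (V : choiceType) (p : R)
    (d d' : V -> R) : Prop :=
  (forall v, d v <= d' v <= 1) /\
  exists2 S : {fset V}, (forall v, v \notin S -> d' v = d v)
                      & \sum_(v <- S) (d' v - d v) <= p.

Definition fractional_rules (R : realType) (V : choiceType) (p : R) :
    devilRules V :=
  @DevilRules V (V -> R) (fun=> 0) (fractional_turn p) (fun d v => d v < 1).

Definition biased_turn (V : choiceType) (b : nat) (B B' : {fset V}) : Prop :=
  B `<=` B' /\ (#|` B' `\` B| <= b)%N.

Definition biased_rules (V : choiceType) (b : nat) : devilRules V :=
  @DevilRules V {fset V} fset0 (@biased_turn V b) (fun B v => v \notin B).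

Definition angel_wins_fractional (R : realType) (p : R) (G : rootedDigraph) :
    Prop :=
  angel_wins (fractional_rules (vertex G) p).

Definition angel_wins_biased (b : nat) (G : rootedDigraph) : Prop :=
  angel_wins (biased_rules (vertex G) b).

(* Main.v *)
Require Import Defs.
From mathcomp Require Import all_boot all_order all_algebra.
From mathcomp Require Import finmap boolp reals.
From mathcomp Require Import zify ring lra.
Set Implicit Arguments.
Unset Strict Implicit.
Unset Printing Implicit Defensive.
Import Order.TTheory GRing.Theory Num.Theory.
Local Open Scope ring_scope.

(** Angel plays a coarse game whose vertices are regions of the fine one. A
coarse vertex is damaged in proportion to the total damage of its region, so N
fine turns of power q make one coarse turn of power N q / D, where D is the
total damage that counts as the destruction of a region.

On the wedge W^3, redrawn as "stay or step in one of two directions", the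
entry points of a region form a box of side t, and a coarse move is a path of
N = 7t + 1 steps to an entry point of the next region. The target u is free
and most of the path is translated along with it, so averaging over u only a
(t+1)^-2 fraction of the damage of a region matters. Hence D = N is affordable
once (t+1)^2 is a large multiple of N: the game of power p = 1/(5N) then
contains a coarse copy of itself with the same power, and surviving T + 1
coarse moves means surviving N (T + 1) >= T + 2 fine ones.

On W^(24b) the coordinates form three blocks of 8b, and the block sums of
Angel's position follow a prescribed pattern: 12b steps in each block, then one
step in the block that the W^3 strategy (power p again) selects. Within the
prescribed block the coordinate is free, and it is chosen to keep down the sum
over k of (6/5)^(k-1) times the expected damage met k steps ahead by a random
walk following the pattern. One step divides this sum by 6/5; a turn of Devil
adds at most b/(8b) to it, since no vertex is visited with probability more
than (5/6)^(k-1)/(8b) after k steps; and the newly visible step adds at most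
1/25, since that probability is minute at distance 36b + 1. *)

Lemma sum_uniq_sub (R : numDomainType) (V : eqType) (s1 s2 : seq V)
    (P : pred V) (f : V -> R) :
  uniq s1 -> uniq s2 -> (forall v, 0 <= f v) ->
  (forall v, v \notin s2 -> f v = 0) -> {in s1, forall v, P v} ->
  \sum_(v <- s1) f v <= \sum_(v <- s2 | P v) f v.
Proof.
move=> u1 u2 f0 fs2 s1P.
rewrite (bigID (mem s2)) /= [X in _ + X]big1 ?addr0; last by move=> v /fs2.
rewrite -big_filter (perm_big [seq v <- s2 | v \in s1]); last first.
  apply: uniq_perm; rewrite ?filter_uniq // => v.
  by rewrite !mem_filter andbC.
rewrite big_filter big_mkcond [leRHS]big_mkcond.
apply: ler_sum => v _; case: ifP => [/s1P ->//|_].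
by case: ifP.
Qed.

(** * Turns of Devil *)

Section Turns.
Variables (R : realType) (V : choiceType).
Implicit Types (d : V -> R) (p q : R).

Lemma turn_ge p d d' v : fractional_turn p d d' -> d v <= d' v.
Proof. by case=> /(_ v)/andP[]. Qed.

Lemma turn_le1 p d d' v : fractional_turn p d d' -> d' v <= 1.
Proof. by case=> /(_ v)/andP[]. Qed.

Lemma turn_sum p d d' s : fractional_turn p d d' -> uniq s ->
  \sum_(v <- s) d' v <= \sum_(v <- s) d v + p.
Proof.
move=> tn us; case: (tn) => _ [S dS sumS].
rewrite -lerBlDl -sumrB; apply: le_trans sumS.
apply: (sum_uniq_sub (P := predT)) => // [v|v /dS->]; last by rewrite subrr.
by rewrite subr_ge0 (turn_ge v tn).
Qed.

Lemma turn_pt p d d' v : fractional_turn p d d' -> d' v <= d v + p.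
Proof. by move=> tn; have := turn_sum tn (isT : uniq [:: v]); rewrite !big_seq1. Qed.

Lemma turn_refl d : (forall v, d v <= 1) -> fractional_turn 0 d d.
Proof.
move=> d1; split=> [v|]; first by rewrite lexx d1.
by exists fset0 => //; rewrite big_seq_fset0.
Qed.

Lemma turn_trans p q d d' d'' : fractional_turn p d d' ->
  fractional_turn q d' d'' -> fractional_turn (p + q) d d''.
Proof.
move=> t1 t2; split=> [v|].
  by rewrite (le_trans (turn_ge v t1) (turn_ge v t2)) (turn_le1 v t2).
have [_ [S1 d1 _]] := t1; have [_ [S2 d2 _]] := t2.
exists (S1 `|` S2)%fset => [v|].
  by rewrite inE negb_or => /andP[/d1 e1 /d2 ->].
have u12 := fset_uniq (S1 `|` S2)%fset.
have := turn_sum t1 u12; have := turn_sum t2 u12.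
rewrite sumrB; lra.
Qed.

End Turns.

(** * Finite horizons, and the passage to infinite play *)

Section Survival.
Variables (R : realType) (V : choiceType) (I : finType) (mv : I -> V -> V).
Variable p : R.

Fixpoint survives (T : nat) (x : V) (d : V -> R) : Prop :=
  if T is T'.+1 then
    exists2 i, d (mv i x) < 1 &
      forall d', fractional_turn p d d' -> survives T' (mv i x) d'
  else True.

Lemma survives_leq T T' x d : (T <= T')%N -> survives T' x d -> survives T x d.
Proof.
elim: T T' x d => [//|T IH] [//|T'] x d leT [i di w].
by exists i => // d' /w; apply: IH.
Qed.

(** Compactness: there are finitely many moves, so if each of them failed at some horizon, Angel
    could not survive one move more than the largest of these horizons. *)
Lemma survives_forever x d : (forall T, survives T x d) ->
  exists i, d (mv i x) < 1 /\
    forall d', fractional_turn p d d' -> forall T, survives T (mv i x) d'.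
Proof.
move=> surv; apply: contrapT => noi.
have bad i : exists T, d (mv i x) < 1 ->
    ~ forall d', fractional_turn p d d' -> survives T (mv i x) d'.
  have [di|di] := pselect (d (mv i x) < 1); last by exists 0%N.
  apply: contrapT => noT; apply: noi; exists i; split=> // d' tn T.
  apply: contrapT => nT; apply: noT; exists T => _; apply/existsNP.
  by exists d' => /(_ tn).
have [T badT] := choice bad.
have [i di w] := surv (\max_i T i).+1.
case: (badT i di) => d' /w; apply: survives_leq; exact: leq_bigmax.
Qed.

(** Devil has made only [s] turns when Angel takes step [s + 1], so a path planned in advance stays
    open if its damage leaves room for [p *+ s]. *)
Lemma survives_path (w : nat -> V) N T d : 0 <= p -> (forall v, d v <= 1) ->
  (forall s, (s < N)%N -> exists i, w s.+1 = mv i (w s)) ->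
  (forall s, (s < N)%N -> d (w s.+1) + p *+ s < 1) ->
  (forall d', fractional_turn (p *+ N) d d' -> survives T (w N) d') ->
  survives (N + T) (w 0%N) d.
Proof.
move=> p0; elim: N w d => [|N IH] w d d1 wmv wd wN.
  by apply: (wN d); rewrite mulr0n; apply: turn_refl.
rewrite addSn /=; have [i wi] := wmv 0%N isT.
exists i => [|d' tn]; rewrite -wi; first by have:= wd 0%N isT; rewrite mulr0n addr0.
apply: (IH (fun s => w s.+1)) => [v|s sN|s sN|d'' tn'].
- exact: turn_le1 tn.
- exact: wmv.
- by apply: le_lt_trans (wd s.+1 sN); rewrite mulrS addrA lerD2r (turn_pt _ tn).
- by apply: wN; rewrite mulrS; apply: turn_trans tn tn'.
Qed.

End Survival.

(** * Coarse games *)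

Section Charge.
Variables (R : realType) (V V' : choiceType) (zeta : V -> V') (D : R).
Hypothesis D_gt0 : 0 < D.

Definition fibre_le (d : V -> R) z (c : R) :=
  forall s, uniq s -> all (fun v => zeta v == z) s -> \sum_(v <- s) d v <= c.

(* The coarse damage is capped at 1, hence no bound where it has reached 1. *)
Definition charged (d : V -> R) (dh : V' -> R) :=
  forall z, dh z < 1 -> fibre_le d z (D * dh z).

Lemma fibre_le_turn d d' z c q :
  fibre_le d z c -> fractional_turn q d d' -> fibre_le d' z (c + q).
Proof.
move=> dz tn s us sz; apply: le_trans (turn_sum tn us) _.
by rewrite lerD2r dz.
Qed.

(** The coarse Devil adds to each region the damage newly laid in it, divided by [D]. Every fine
    vertex lies in one region, so these increments sum to at most [q / D]. *)
Lemma charged_turn q d d' dh : (forall z, dh z <= 1) -> charged d dh ->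
  fractional_turn q d d' ->
  exists2 dh', fractional_turn (q / D) dh dh' & charged d' dh'.
Proof.
move=> dh1 chd tn; have [_ [S dS sumS]] := tn.
have dl0 v : 0 <= d' v - d v by rewrite subr_ge0 (turn_ge v tn).
pose inc z := (\sum_(v <- S | zeta v == z) (d' v - d v)) / D.
have inc0 z : 0 <= inc z.
  by rewrite divr_ge0 ?(ltW D_gt0)// sumr_ge0.
exists (fun z => Num.min 1 (dh z + inc z)).
  split=> [z|].
    by rewrite ge_min lexx le_min dh1 /= lerDl inc0.
  exists [fset zeta v | v in S]%fset => [z zS|].
    rewrite (_ : inc z = 0) ?addr0; first by apply/min_idPr/dh1.
    rewrite /inc big_seq_cond big1 ?mul0r// => v /andP[vS /eqP zv].
    by case/negP: zS; rewrite -zv in_imfset.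
  apply: le_trans (_ : \sum_(z <- [fset zeta v | v in S]%fset) inc z <= _).
    by apply: ler_sum => z _; rewrite lerBlDl ge_min lexx orbT.
  rewrite -mulr_suml ler_pM2r ?invr_gt0//; apply: le_trans sumS.
  rewrite (exchange_big_dep predT)//= le_eqVlt; apply/orP; left; apply/eqP.
  rewrite big_seq [RHS]big_seq; apply: eq_bigr => v vS.
  rewrite (eq_bigl (pred1 (zeta v))); last by move=> z; rewrite eq_sym.
  by rewrite -big_filter filter_pred1_uniq ?fset_uniq ?in_imfset// big_seq1.
move=> z; rewrite gt_min ltxx /= => hz s us sz.
have hz' : dh z < 1 by apply: le_lt_trans hz; rewrite lerDl.
rewrite min_r ?(ltW hz)// mulrDr [D * inc z]mulrC divfK ?gt_eqF//.
have incs : \sum_(v <- s) (d' v - d v) <= \sum_(v <- S | zeta v == z) (d' v - d v).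
  apply: sum_uniq_sub => // [v /dS ->|v /(allP sz)//]; exact: subrr.
have := chd z hz' s us sz; rewrite sumrB in incs.
by move: incs; rewrite lerBlDr addrC => incs ds; apply: le_trans incs _; rewrite lerD2r.
Qed.

End Charge.

(** * The lattice game on W^3 *)

Lemma exists_le_mean (R : realDomainType) (U : finType) (P : pred U)
    (f : U -> R) (c : R) :
  (0 < #|P|)%N -> \sum_(u | P u) f u <= c *+ #|P| -> exists2 u, P u & f u <= c.
Proof.
move=> P0 sumf; apply: contrapT => nof.
have fc u : P u -> c < f u.
  by move=> Pu; rewrite ltNge; apply/negP => fu; apply: nof; exists u.
have [u0 Pu0] := card_gt0P P0.
suff: c *+ #|P| < \sum_(u | P u) f u by rewrite ltNge sumf.
rewrite -sumr_const; apply: ltr_sum => //.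
by apply/hasP; exists u0; rewrite ?mem_index_enum.
Qed.

(** The points [pos s u] are distinct and lie in one region, so its damage bounds their sum.
    Averaging over [u] then gains a factor [#|U|]. *)
Lemma sum_grid_le (R : realType) (V V' : choiceType) (zeta : V -> V')
    (d : V -> R) z c (U : finType) (pos : nat -> U -> V) s1 s2 :
  fibre_le zeta d z c ->
  (forall s u, (s1 <= s < s2)%N -> zeta (pos s u) = z) ->
  (forall s s' u u', (s1 <= s < s2)%N -> (s1 <= s' < s2)%N ->
     pos s u = pos s' u' -> s = s' /\ u = u') ->
  \sum_(s1 <= s < s2) \sum_u d (pos s u) <= c.
Proof.
move=> dz zpos ipos.
rewrite (eq_bigr (fun s => \sum_(u <- enum U) d (pos s u))); last first.
  by move=> s _; rewrite big_enum.
rewrite -(big_allpairs_dep (h := pos) (F := d)).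
apply: dz; last first.
  by apply/allP => v /allpairsP[[s u] /= [hs _ ->]]; rewrite zpos -?mem_index_iota.
apply: allpairs_uniq; rewrite ?iota_uniq ?enum_uniq//.
move=> [s u] [s' u'] /allpairsP[[x1 x2] [/= h1 _ [-> ->]]].
move=> /allpairsP[[x1' x2'] [/= h1' _ [-> ->]]] e.
by rewrite !mem_index_iota in h1 h1'; have [-> ->] := ipos _ _ _ _ h1 h1' e.
Qed.

(* Vertices of W^3 as (level, two of the three coordinates); move 0 increases
   the remaining coordinate. *)
Definition site : choiceType := (nat * nat * nat)%type.

Definition site_move (i : 'I_3) (v : site) : site :=
  (v.1.1.+1, v.1.2 + (i == 1%N :> nat), v.2 + (i == 2%N :> nat))%N.

(** * Paths between entry boxes, and the regions charged for them *)

Section LatticePaths.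
Variables (t : nat) (t_gt0 : (0 < t)%N).
Let a := (3 * t).+1.
Let N := (7 * t).+1.
Local Notation U := ('I_t.+1 * 'I_t.+1)%type.

(* From entry point u0 of the corner y: displacement u during 2t steps, then
   (t, t) - u0 during 2t steps, then a steps in direction i. The truncated
   minimums make the first two phases wait once they are complete. *)
Definition lpath (y : site) (u0 u : U) (i : 'I_3) (s : nat) : site :=
  (y.1.1 + s,
   y.1.2 + u0.1 + minn s u.1 + minn (s - 2 * t) (t - u0.1)
     + (s - 4 * t) * (i == 1%N :> nat),
   y.2 + u0.2 + minn (s - u.1) u.2 + minn (s - 2 * t - (t - u0.1)) (t - u0.2)
     + (s - 4 * t) * (i == 2%N :> nat))%N.

(** A round displaces [u0] by [u], by [(t, t) - u0], and by [a] steps in one direction, so the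
    corner moves by [(t, t)] plus the run, whatever [u0] and [u] are. *)
Definition corner (y z : site) : site :=
  (y.1.1 + N * z.1.1, y.1.2 + t * z.1.1 + a * z.1.2,
   y.2 + t * z.1.1 + a * z.2)%N.

(* The run in direction i must be charged to the old region while u hides i and
   to the new one at its end; the switch takes place t levels before the end
   of the run. Off the paths the values are junk. *)
Definition lzone (y v : site) : site :=
  let l := (v.1.1 - y.1.1 + t)%N in
  let m := (l %/ N)%N in
  if (l %% N < 5 * t)%N then
    (m, (v.1.2 + t - y.1.2 - t * m) %/ a, (v.2 + t - y.2 - t * m) %/ a)%N
  else
    (m, (v.1.2 - t - y.1.2 - t * m) %/ a, (v.2 - t - y.2 - t * m) %/ a)%N.

Lemma divmod_unique k q r c : (0 < c)%N -> k = (q * c + r)%N -> (r < c)%N ->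
  (k %/ c = q)%N /\ (k %% c = r)%N.
Proof.
by move=> c0 -> rc; rewrite divnMDl // divn_small // addn0 modnMDl modn_small.
Qed.

Lemma minn_subS e c s :
  minn (s.+1 - e) c = (minn (s - e) c + (e <= s < e + c))%N.
Proof. lia. Qed.

Lemma lpath_step y u0 u i s :
  exists j, lpath y u0 u i s.+1 = site_move j (lpath y u0 u i s).
Proof.
have [u01 u02 u1 u2] := And4 (ltn_ord u0.1) (ltn_ord u0.2) (ltn_ord u.1)
  (ltn_ord u.2).
(* The direction of step [s + 1], phase by phase; waiting is a move in direction 0. *)
pose j := if (s < u.1)%N then 1%N else if (s < u.1 + u.2)%N then 2%N else
  if (s < 2 * t)%N then 0%N else if (s < 2 * t + (t - u0.1))%N then 1%N else
  if (s < 2 * t + (t - u0.1) + (t - u0.2))%N then 2%N else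
  if (s < 4 * t)%N then 0%N else i.
have j3 : (j < 3)%N by rewrite /j; do !case: ifP => _.
have run (b : bool) : ((s.+1 - 4 * t) * b = (s - 4 * t) * b + (b && (4 * t <= s)))%N.
  by case: b; rewrite ?muln0 // !muln1; lia.
exists (Ordinal j3); rewrite /lpath /site_move /= -!subnDA !minn_subS !run.
have := minn_subS 0 u.1 s; rewrite !subn0 add0n => ->.
have j1 : ((0 <= s < u.1) + (2 * t <= s < 2 * t + (t - u0.1)) +
    ((i == 1%N :> nat) && (4 * t <= s)) = (j == 1%N))%N.
  by rewrite /j; case: (nat_of_ord i) => [|[|[|x]]]; do !case: ifP => ? /=; lia.
have j2 : ((u.1 <= s < u.1 + u.2) + (2 * t + (t - u0.1) <= s <
    2 * t + (t - u0.1) + (t - u0.2)) +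
    ((i == 2%N :> nat) && (4 * t <= s)) = (j == 2%N))%N.
  by rewrite /j; case: (nat_of_ord i) => [|[|[|x]]]; do !case: ifP => ? /=; lia.
congr (_, _, _); first by rewrite addnS.
  by rewrite -j1; ring.
by rewrite -j2; ring.
Qed.

(** Relative to the corner, the recorded coordinates lie in [0, 2t] before level 4t, and in [t, 4t]
    from there to level 6t. The shifts by [t] in [lzone] bring both ranges into [0, 3t], a cell of
    side [a = 3t + 1]. *)
Lemma lzone_near y z u0 u i s : (s < (6 * t).+1)%N ->
  lzone y (lpath (corner y z) u0 u i s) = z.
Proof.
have [u01 u02 u1 u2] := And4 (ltn_ord u0.1) (ltn_ord u0.2) (ltn_ord u.1)
  (ltn_ord u.2).
case: z => [[m z1] z2] st; rewrite /lzone /=.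
have [-> ->] : ((y.1.1 + N * m + s - y.1.1 + t) %/ N = m)%N /\
    ((y.1.1 + N * m + s - y.1.1 + t) %% N = s + t)%N.
  by apply: divmod_unique => //; [rewrite (mulnC m); lia | rewrite /N; lia].
case: ifP => sl.
  have s4 : (s - 4 * t = 0)%N by rewrite /N in sl *; lia.
  rewrite s4 !mul0n !addn0; congr (_, _, _).
  - pose r := (u0.1 + minn s u.1 + minn (s - 2 * t) (t - u0.1) + t)%N.
  apply: (proj1 (@divmod_unique _ _ r _ _ _ _)) => //; rewrite /r; last by rewrite /a; lia.
  by rewrite (mulnC z1); lia.
  - pose r := (u0.2 + minn (s - u.1) u.2 + minn (s - 2 * t - (t - u0.1)) (t - u0.2) + t)%N.
  apply: (proj1 (@divmod_unique _ _ r _ _ _ _)) => //; rewrite /r; last by rewrite /a; lia.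
  by rewrite (mulnC z2); lia.
have [-> -> -> ->] : [/\ minn s u.1 = u.1, minn (s - u.1) u.2 = u.2,
    minn (s - 2 * t) (t - u0.1) = (t - u0.1)%N &
    minn (s - 2 * t - (t - u0.1)) (t - u0.2) = (t - u0.2)%N].
  by split; lia.
congr (_, _, _).
- pose r := (u.1 + (s - 4 * t) * (i == 1%N :> nat))%N.
  apply: (proj1 (@divmod_unique _ _ r _ _ _ _)) => //; rewrite /r; last by rewrite /a; case: (_ == _); lia.
  by rewrite (mulnC z1); case: (_ == _); lia.
- pose r := (u.2 + (s - 4 * t) * (i == 2%N :> nat))%N.
  apply: (proj1 (@divmod_unique _ _ r _ _ _ _)) => //; rewrite /r; last by rewrite /a; case: (_ == _); lia.
  by rewrite (mulnC z2); case: (_ == _); lia.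
Qed.

(** After level 6t the run has made at least [2t + 1 = a - t] steps, so adding [t] carries the
    coordinate of direction [i] into the next cell. *)
Lemma lzone_far y z u0 u i s : (6 * t < s <= N)%N ->
  lzone y (lpath (corner y z) u0 u i s) = site_move i z.
Proof.
have [u01 u02 u1 u2] := And4 (ltn_ord u0.1) (ltn_ord u0.2) (ltn_ord u.1)
  (ltn_ord u.2).
case: z => [[m z1] z2] /andP[st sN]; rewrite /lzone /=.
have [-> ->] : ((y.1.1 + N * m + s - y.1.1 + t) %/ N = m.+1)%N /\
    ((y.1.1 + N * m + s - y.1.1 + t) %% N = s + t - N)%N.
  apply: divmod_unique => //; last by rewrite /N in sN *; lia.
  by rewrite mulSn (mulnC m); move: (N * m)%N => x; rewrite /N in sN *; lia.
rewrite ifT; last by rewrite /N in sN *; lia.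
have [-> -> -> ->] : [/\ minn s u.1 = u.1, minn (s - u.1) u.2 = u.2,
    minn (s - 2 * t) (t - u0.1) = (t - u0.1)%N &
    minn (s - 2 * t - (t - u0.1)) (t - u0.2) = (t - u0.2)%N].
  by split; lia.
rewrite /site_move /=; congr (_, _, _).
- pose r := (t + u.1 + (s - 4 * t) * (i == 1%N :> nat) - a * (i == 1%N :> nat))%N.
  apply: (proj1 (@divmod_unique _ _ r _ _ _ _)) => //; rewrite /r; last first.
    by rewrite /a /N in sN *; case: (_ == _); lia.
  rewrite mulnDl mulnS (mulnC z1); move: (a * z1)%N (t * m)%N => x x'.
  by rewrite /a /N in sN *; case: (_ == _); lia.
- pose r := (t + u.2 + (s - 4 * t) * (i == 2%N :> nat) - a * (i == 2%N :> nat))%N.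
  apply: (proj1 (@divmod_unique _ _ r _ _ _ _)) => //; rewrite /r; last first.
    by rewrite /a /N in sN *; case: (_ == _); lia.
  rewrite mulnDl mulnS (mulnC z2); move: (a * z2)%N (t * m)%N => x x'.
  by rewrite /a /N in sN *; case: (_ == _); lia.
Qed.

Definition entry (y z : site) (u : U) : site :=
  ((corner y z).1.1, (corner y z).1.2 + u.1, (corner y z).2 + u.2)%N.

Lemma lpath0 y z u0 u i : lpath (corner y z) u0 u i 0 = entry y z u0.
Proof. by rewrite /lpath /entry !sub0n !min0n !mul0n !addn0. Qed.

Lemma lpath_N y z u0 u i :
  lpath (corner y z) u0 u i N = entry y (site_move i z) u.
Proof.
have [u01 u02 u1 u2] := And4 (ltn_ord u0.1) (ltn_ord u0.2) (ltn_ord u.1)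
  (ltn_ord u.2).
case: z => [[m z1] z2]; rewrite /lpath /entry /site_move /=.
have [-> -> -> -> ->] : [/\ minn N u.1 = u.1, minn (N - u.1) u.2 = u.2,
    minn (N - 2 * t) (t - u0.1) = (t - u0.1)%N,
    minn (N - 2 * t - (t - u0.1)) (t - u0.2) = (t - u0.2)%N & (N - 4 * t = a)%N].
  by rewrite /N /a; split; lia.
rewrite !mulnS !mulnDr; congr (_, _, _); first by lia.
  by move: (t * m)%N (a * z1)%N (a * _)%N => ? ? ?; lia.
by move: (t * m)%N (a * z2)%N (a * _)%N => ? ? ?; lia.
Qed.

Lemma lpath_early y u0 u i s : (s <= 4 * t)%N ->
  lpath y u0 u i s = lpath y u0 u ord0 s.
Proof.
by move=> s4; rewrite /lpath (_ : (s - 4 * t)%N = 0%N) ?mul0n//; lia.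
Qed.

Lemma lpath_inj_time y u0 u u' u0' i s s' :
  lpath y u0 u i s = lpath y u0' u' i s' -> s = s'.
Proof. by case=> /addnI. Qed.

(** Until level 2t the path is the displacement by [u] translated along with its start [u0]. *)
Lemma lpath_inj_start y u i s s' u0 u0' : (s <= 2 * t)%N ->
  lpath y u0 u i s = lpath y u0' u i s' -> s = s' /\ u0 = u0'.
Proof.
move=> st e; have es := lpath_inj_time e; rewrite -{}es in e *.
split=> //; case: e; rewrite (eqP (_ : s - 2 * t == 0)%N) //.
rewrite !sub0n !min0n !addn0.
move=> /addIn/addIn/addnI/val_inj e1 /addIn/addIn/addnI/val_inj e2.
exact: injective_projections.
Qed.

(** By level 2t the displacement [u] is complete, and the rest of the path is translated along with
    it. *)
Lemma lpath_inj_target y u0 i s s' u u' : (2 * t <= s)%N ->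
  lpath y u0 u i s = lpath y u0 u' i s' -> s = s' /\ u = u'.
Proof.
move=> st e; have es := lpath_inj_time e; rewrite -{}es in e *.
have target (v : U) : minn s v.1 = v.1 /\ minn (s - v.1) v.2 = v.2.
  by have := ltn_ord v.1; have := ltn_ord v.2; split; lia.
split=> //; case: e; rewrite !(proj1 (target _)) !(proj2 (target _)).
move=> /addIn/addIn/addnI/val_inj e1 /addIn/addIn/addnI/val_inj e2.
exact: injective_projections.
Qed.

End LatticePaths.

(** * Self-simulation of the lattice game *)

Section LatticeGame.
Variables (R : realType) (t : nat) (t_gt0 : (0 < t)%N).
Let N := (7 * t).+1.
Local Notation U := ('I_t.+1 * 'I_t.+1)%type.
Let W : R := #|{: U}|%:R.
Let p : R := (5 * N%:R)^-1.
Hypothesis wide : 24 * (N%:R + 1 / 5) <= W.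

(** Only the first 4t steps count: they do not depend on the direction, which the coarse game has
    yet to choose, so [ord0] stands for any direction. *)
Definition path_cost (d : site -> R) (y : site) (u0 u : U) : R :=
  \sum_(1 <= s < (4 * t).+1) d (lpath y u0 u ord0 s).

Lemma path_cost_turn q d d' y u0 u : fractional_turn q d d' ->
  path_cost d' y u0 u <= path_cost d y u0 u + q.
Proof.
move=> tn; rewrite /path_cost.
rewrite -!(big_map (lpath y u0 u ord0) predT) (turn_sum tn)//.
by rewrite map_inj_uniq ?iota_uniq// => s s'; apply: lpath_inj_time.
Qed.

(** The first half of the path is injective in the start for a fixed target, the second half in the
    target for a fixed start. Each half thus costs at most [c] for each of the [W] values of the
    fixed parameter. *)
Lemma sum_path_cost_le d y z c : fibre_le (lzone t y) d z c ->
  \sum_u \sum_u' path_cost d (corner t y z) u u' <= W * (2 * c).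
Proof.
move=> dz; rewrite mulrDl mul1r mulrDr.
have halves u u' : path_cost d (corner t y z) u u' =
    \sum_(1 <= s < (2 * t).+1) d (lpath (corner t y z) u u' ord0 s) +
    \sum_((2 * t).+1 <= s < (4 * t).+1) d (lpath (corner t y z) u u' ord0 s).
  by rewrite -big_cat_nat //=; lia.
under eq_bigr do under eq_bigr do rewrite halves.
under eq_bigr do rewrite big_split.
rewrite big_split; apply: lerD.
  rewrite exchange_big [leRHS]mulr_natl -sumr_const; apply: ler_sum => u' _.
  rewrite exchange_big; apply: (sum_grid_le
    (pos := fun s u => lpath (corner t y z) u u' ord0 s)) dz _ _.
    by move=> s u st; apply: lzone_near; lia.
  by move=> s s' u u1 st st'; apply: lpath_inj_start; lia.
rewrite [leRHS]mulr_natl -sumr_const; apply: ler_sum => u _.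
rewrite exchange_big; apply: (sum_grid_le
  (pos := fun s u' => lpath (corner t y z) u u' ord0 s)) dz _ _.
  by move=> s u' st; apply: lzone_near; lia.
by move=> s s' u' u1 st st'; apply: lpath_inj_target; lia.
Qed.

(* The final value 4/15 leaves room for the 1/5 that Devil adds on the way, and
   4/5 = 7/15 + 8/24 = 3 * 4/15. *)
Lemma good_target d y z i u0 : (forall v, 0 <= d v) ->
  fibre_le (lzone t y) d z (N%:R + 1 / 5) ->
  fibre_le (lzone t y) d (site_move i z) (N%:R + 1 / 5) ->
  \sum_u path_cost d (corner t y z) u0 u <= W * (7 / 15) ->
  exists u, (forall s, (1 <= s <= N)%N ->
      d (lpath (corner t y z) u0 u i s) <= 4 / 5) /\
    \sum_u' path_cost d (corner t y (site_move i z)) u u' <= W * (4 / 15).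
Proof.
move=> d0 dz dz' cost.
have W0 : 0 < W by rewrite ltr0n; apply/card_gt0P; exists (ord0, ord0).
pose pathsum u := \sum_(1 <= s < N.+1) d (lpath (corner t y z) u0 u i s).
pose next u := \sum_u' path_cost d (corner t y (site_move i z)) u u'.
have next0 u : 0 <= next u.
  by apply: sumr_ge0 => u' _; apply: sumr_ge0.
have sumP : \sum_u pathsum u <= W * (7 / 15) + (N%:R + 1 / 5) + (N%:R + 1 / 5).
  (* The first part is controlled by the invariant, the second is charged to the old region and the
     third to the new one. *)
  have split_path u : pathsum u = path_cost d (corner t y z) u0 u +
      \sum_((4 * t).+1 <= s < (6 * t).+1) d (lpath (corner t y z) u0 u i s) +
      \sum_((6 * t).+1 <= s < N.+1) d (lpath (corner t y z) u0 u i s).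
    rewrite /pathsum (big_cat_nat (n := (6 * t).+1)) ?ltnS//=; last by rewrite /N; lia.
    rewrite (big_cat_nat (n := (4 * t).+1)) ?ltnS//=; last by lia.
    congr (_ + _ + _); rewrite /path_cost !big_nat.
    by apply: eq_bigr => s /andP[_ st]; rewrite lpath_early.
  under eq_bigr do rewrite split_path.
  rewrite 2!big_split /= lerD// ?lerD//.
    rewrite exchange_big; apply: (sum_grid_le
      (pos := fun s u => lpath (corner t y z) u0 u i s)) dz _ _.
      by move=> s u st; apply: lzone_near; lia.
    by move=> s s' u u1 st st'; apply: lpath_inj_target; lia.
  rewrite exchange_big; apply: (sum_grid_le
    (pos := fun s u => lpath (corner t y z) u0 u i s)) dz' _ _.
    by move=> s u st; apply: lzone_far; lia.
  by move=> s s' u u1 st st'; apply: lpath_inj_target; lia.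
have sumN : \sum_u next u <= W * (2 * (N%:R + 1 / 5)) by exact: sum_path_cost_le.
(* One average meets both demands, as both terms are nonnegative: the path contributes at most 7/15
   + 2/24, and three times the next mean cost at most 6/24. *)
have [||u _ hu] := @exists_le_mean _ {: U} predT
    (fun u => pathsum u + 3 * (next u / W)) (4 / 5).
  by apply/card_gt0P; exists (ord0, ord0).
  rewrite big_split /= -mulr_sumr -mulr_suml -mulr_natl -/W.
  have : (\sum_u next u) / W <= 2 * (N%:R + 1 / 5) by rewrite ler_pdivrMr// mulrC.
  move: wide sumP; lra.
have nW0 : 0 <= next u / W by rewrite divr_ge0// ltW.
exists u; split=> [s /andP[s1 sN]|].
  apply: le_trans (_ : pathsum u <= _); last by lra.
  rewrite /pathsum (bigD1_seq s) ?iota_uniq ?mem_index_iota ?s1//=.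
  by rewrite lerDl sumr_ge0.
have P0 : 0 <= pathsum u by exact: sumr_ge0.
rewrite -/(next u) mulrC -ler_pdivrMr//; lra.
Qed.

(** The current region is bounded by [N + 1/5] because Devil may have destroyed it during the round
    that led there; 7/15 is 4/15 plus the 1/5 of that round. The [N] turns of a round form one
    coarse turn of power [p N / N = p]. *)
Lemma lattice_simulation T y z dh d u0 :
  survives site_move p T z dh -> (forall z, dh z <= 1) ->
  (forall v, 0 <= d v <= 1) -> charged (lzone t y) N%:R d dh ->
  fibre_le (lzone t y) d z (N%:R + 1 / 5) ->
  \sum_u path_cost d (corner t y z) u0 u <= W * (7 / 15) ->
  survives site_move p (N * T) (entry y z u0) d.
Proof.
have N0 : 0 < N%:R :> R by rewrite ltr0n.
have pN : p *+ N = 1 / 5 by rewrite /p -mulr_natr; field; rewrite gt_eqF.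
have p0 : 0 <= p by rewrite invr_ge0 mulr_ge0.
elim: T z dh d u0 => [|T IH] z dh d u0; first by rewrite muln0.
move=> [i dhi surv] dh1 d01 chd dz cost.
have d0 v : 0 <= d v by case/andP: (d01 v).
have dz' : fibre_le (lzone t y) d (site_move i z) N%:R.
  move=> s us sz; apply: le_trans (chd _ dhi s us sz) _.
  by rewrite ler_piMr ?ltW.
have [|u [path_ok next_ok]] := good_target d0 dz _ cost (i := i).
  by move=> s us sz; apply: le_trans (dz' s us sz) _; lra.
rewrite mulnS -(lpath0 y z u0 u i).
apply: (survives_path (w := lpath (corner t y z) u0 u i)) => //.
- by move=> v; case/andP: (d01 v).
- by move=> s sN; apply: lpath_step.
(* Devil has spent less than [p N = 1/5] before the last step, on top of the initial 4/5. *)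
- move=> s sN; have := path_ok s.+1 sN.
  suff : p *+ s < 1 / 5 by lra.
  rewrite -pN -mulr_natr -[ltRHS]mulr_natr ltr_pM2l ?ltr_nat//.
  by rewrite invr_gt0 mulr_gt0.
move=> d' tn; rewrite lpath_N//.
have [dh' tnh chd'] := charged_turn N0 dh1 chd tn.
have tnp : fractional_turn p dh dh'.
  by move: tnh; rewrite -[p *+ N]mulr_natr mulfK ?gt_eqF.
apply: (IH _ dh') => //.
- exact: surv.
- by move=> z'; apply: turn_le1 tnh.
- by move=> v; rewrite (turn_le1 v tn) (le_trans (d0 v) (turn_ge v tn)).
- by rewrite -pN; apply: fibre_le_turn tn.
apply: le_trans (_ : \sum_u' (path_cost d (corner t y (site_move i z)) u u' + p *+ N) <= _).
  by apply: ler_sum => u' _; apply: path_cost_turn.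
rewrite big_split /= sumr_const -[_ *+ #|_|]mulr_natl -/W pN; lra.
Qed.

(** The coarse game has the same moves and the same power, so the horizon bootstraps itself by
    induction. *)
Lemma lattice_survives T y : survives site_move p T y (fun=> 0).
Proof.
(* The horizon must start at 1, since multiplying 0 by [N] gains nothing. *)
suff: survives site_move p T.+1 y (fun=> 0) by apply: survives_leq.
elim: T y => [|T IH] y; first by exists ord0.
apply: (@survives_leq _ _ _ _ _ _ (N * T.+1)); first by rewrite /N; lia.
have -> : y = @entry t y (0, 0, 0)%N (ord0, ord0).
  by case: y => [[y1 y2] y3]; rewrite /entry /corner /= !muln0 !addn0.
have N0 : 0 <= N%:R :> R by [].
apply: (lattice_simulation (IH (0, 0, 0)%N)) => //.
- by move=> v; rewrite lexx ler01.
- by move=> z _ s _ _; rewrite big1 ?mulr0.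
- by move=> s _ _; rewrite big1 //; lra.
rewrite big1 => [|u _]; last by rewrite /path_cost big1.
by rewrite mulr_ge0 //; lra.
Qed.

End LatticeGame.

(** * Random walks along a sequence of blocks *)

Section Walk.
Variables (R : realType) (C B : finType) (blk : C -> B) (m : nat).
Hypotheses (m_gt0 : (0 < m)%N).
Hypothesis card_blk : forall be, #|[pred j | blk j == be]| = m.
Local Notation V := {ffun C -> nat}.

Definition incr (j : C) (x : V) : V := [ffun k => x k + (k == j)]%N.

Definition blksum (be : B) (x : V) : nat := (\sum_(j | blk j == be) x j)%N.

(** The expected value of [d] at the end of the random walk from [x] whose successive steps increase
    a uniformly chosen coordinate of the successive blocks of [l]. *)
Fixpoint walk (l : seq B) (d : V -> R) (x : V) : R :=
  if l is be :: l' then (\sum_(j | blk j == be) walk l' d (incr j x)) / m%:R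
  else d x.

Lemma walk_ge0 l d x : (forall v, 0 <= d v) -> 0 <= walk l d x.
Proof.
move=> d0; elim: l x => [|be l IH] x //=.
by rewrite divr_ge0// sumr_ge0.
Qed.

Definition point (v y : V) : R := (y == v)%:R.

Lemma walk_add_points s c d d' l x :
  (forall y, d' y = d y + \sum_(v <- s) c v * point v y) ->
  walk l d' x = walk l d x + \sum_(v <- s) c v * walk l (point v) x.
Proof.
move=> d'E; elim: l x => [|be l IH] x //=.
under eq_bigr do rewrite IH.
rewrite big_split mulrDl /=; congr (_ + _).
rewrite exchange_big mulr_suml; apply: eq_bigr => v _.
by rewrite mulrA mulr_sumr.
Qed.

Lemma sum_point (s : seq V) (c : V -> R) y : uniq s ->
  \sum_(v <- s) c v * point v y = if y \in s then c y else 0.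
Proof.
move=> us; case: ifPn => ys.
  rewrite (bigD1_seq y)//= /point eqxx mulr1 big1 ?addr0// => v vy.
  by rewrite eq_sym (negPf vy) mulr0.
rewrite big_seq big1// => v vs; rewrite /point (_ : (y == v) = false) ?mulr0//.
by apply: contraNF ys => /eqP->.
Qed.

Lemma walk_support l v x : walk l (point v) x != 0 ->
  (forall j, (x j <= v j)%N) /\
  forall be, blksum be v = (blksum be x + count_mem be l)%N.
Proof.
elim: l x => [|be l IH] x /=.
  rewrite /point; case: (x =P v) => [->|_]; last by rewrite eqxx.
  by move=> _; split=> // be; rewrite addn0.
rewrite mulf_eq0 negb_or => /andP[nz _].
have /existsP[j /andP[/eqP bj /IH [xv sumv]]] :
    [exists j, (blk j == be) && (walk l (point v) (incr j x) != 0)].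
  apply: contraNT nz; rewrite negb_exists => /forallP z.
  rewrite big1// => j bj; have := z j; rewrite bj /= negbK => /eqP->//.
split=> [k|be']; first by have := xv k; rewrite ffunE; apply: leq_trans; exact: leq_addr.
rewrite sumv addnA; congr (_ + _)%N; rewrite /blksum.
under eq_bigr do rewrite ffunE.
rewrite big_split /=; congr (_ + _)%N; rewrite -bj; case: eqP => [<-|nb].
  rewrite (bigD1 j) //= eqxx big1 // => k /andP[_ /negPf ->] //.
by rewrite big1 // => k; case: (k =P j) => // -> /eqP /nb.
Qed.

(* Bounds c! / (m^c prod u_j!), the largest probability of a multinomial
   variable on m cells, through u! >= 2^(u-1). *)
Definition visit_bound (c : nat) : R := c`!%:R / (m ^ c * 2 ^ (c - m))%:R.

(** The multinomial formula, as an inequality. A first step in coordinate [j] takes the factor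
    [v j - x j] out of the factorials, and over the first block these factors add up to the number
    of its occurrences. *)
Lemma walk_point_fact l v x :
  walk l (point v) x * (\prod_j (v j - x j)`!)%:R <=
  \prod_be ((count_mem be l)`!%:R / m%:R ^+ count_mem be l).
Proof.
have m0 : 0 < m%:R :> R by rewrite ltr0n.
have C0 l' : 0 <= \prod_be ((count_mem be l')`!%:R / m%:R ^+ count_mem be l') :> R.
  by apply: prodr_ge0 => be _; rewrite divr_ge0// exprn_ge0.
elim: l x => [|be l IH] x.
  rewrite /= [leRHS]big1 => [|be _]; last by rewrite expr0 divr1.
  rewrite /point; case: (x =P v) => [->|_]; last by rewrite mul0r.
  by rewrite mul1r big1 // => j _; rewrite subnn.
have [->|nz] := eqVneq (walk (be :: l) (point v) x) 0; first by rewrite mul0r.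
have [xv sumv] := walk_support nz.
have -> : \prod_be' ((count_mem be' (be :: l))`!%:R / m%:R ^+ count_mem be' (be :: l)) =
    \prod_be' ((count_mem be' l)`!%:R / m%:R ^+ count_mem be' l) *
    ((count_mem be l).+1%:R / m%:R) :> R.
  rewrite (bigD1 be) //= eqxx add1n (bigD1 be (P := predT)) //=.
  rewrite (eq_bigr (fun be' => (count_mem be' l)`!%:R / m%:R ^+ count_mem be' l)); last first.
    by move=> be' /negPf nb; rewrite eq_sym nb.
  rewrite factS natrM exprS invfM; set X := \prod_(_ | _) _; ring.
rewrite /= mulrAC mulrA ler_pM2r ?invr_gt0// mulr_suml.
have -> : ((count_mem be l).+1 = \sum_(j | blk j == be) (v j - x j))%N.
  rewrite sumnB; last by move=> j _; apply: xv.
  have := sumv be; rewrite /blksum /= eqxx => ->; lia.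
rewrite natr_sum mulr_sumr; apply: ler_sum => j _.
have [->|nzj] := eqVneq (walk l (point v) (incr j x)) 0.
  by rewrite mul0r mulr_ge0.
have [xvj _] := walk_support nzj.
have -> : (\prod_k (v k - x k)`! = (v j - x j) * \prod_k (v k - incr j x k)`!)%N.
  rewrite (bigD1 j) // [in RHS](bigD1 j) //= mulnA !ffunE eqxx addn1; congr (_ * _)%N.
    have := xvj j; rewrite ffunE eqxx addn1 => vj.
    by rewrite -(subnSK vj) factS.
  by apply: eq_bigr => k /negPf nk; rewrite ffunE nk addn0.
by rewrite natrM mulrCA mulrC ler_wpM2r.
Qed.

Lemma expn2_fact u : (2 ^ u <= u`! * 2)%N.
Proof.
case: u => // u; rewrite expnS mulnC leq_pmul2r//.
elim: u => // u IH; rewrite expnS factS.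
by apply: leq_mul => //.
Qed.

Lemma walk_point_le l v x :
  walk l (point v) x <= \prod_be visit_bound (count_mem be l).
Proof.
have [->|nz] := eqVneq (walk l (point v) x) 0.
  by apply: prodr_ge0 => be _; rewrite divr_ge0.
have [xv sumv] := walk_support nz.
(* Each of the [m] factors is at least [2 ^ (u_j - 1)]. Multiplying by [2 ^ m] avoids the truncated
   exponents. *)
have blkfact be : (2 ^ (count_mem be l - m) <= \prod_(j | blk j == be) (v j - x j)`!)%N.
  rewrite -(leq_pmul2r (expn_gt0 2 m)).
  have [cm|/ltnW cm] := leqP m (count_mem be l); last first.
    rewrite (eqP cm) mul1n leq_pmull// prodn_gt0// => j; exact: fact_gt0.
  rewrite -expnD subnK//.
  have -> : (count_mem be l = \sum_(j | blk j == be) (v j - x j))%N.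
    rewrite sumnB; last by move=> j _; apply: xv.
    by have := sumv be; rewrite /blksum => ->; rewrite addKn.
  have -> : (2 ^ m = \prod_(j | blk j == be) 2)%N.
    by rewrite -(card_blk be) -prod_nat_const; apply: eq_bigl.
  rewrite expn_sum -big_split /=.
  by apply: leq_prod => j _; exact: expn2_fact.
have factv : (\prod_be 2 ^ (count_mem be l - m) <= \prod_j (v j - x j)`!)%N.
  rewrite (partition_big blk predT)//=; exact: leq_prod.
have w0 : 0 <= walk l (point v) x by apply: walk_ge0 => y; rewrite ler0n.
have e0 : (0 < \prod_be 2 ^ (count_mem be l - m))%N.
  by rewrite prodn_gt0// => be; rewrite expn_gt0.
have -> : \prod_be visit_bound (count_mem be l) =
    \prod_be ((count_mem be l)`!%:R / m%:R ^+ count_mem be l) /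
    (\prod_be 2 ^ (count_mem be l - m))%:R.
  rewrite natr_prod -prodfV -big_split /=; apply: eq_bigr => be _.
  by rewrite /visit_bound natrM invfM mulrA natrX.
rewrite ler_pdivlMr ?ltr0n//; apply: le_trans (walk_point_fact l v x).
by rewrite ler_wpM2l// ler_nat.
Qed.

Lemma blksum_sum x : (\sum_be blksum be x = \sum_j x j)%N.
Proof. by rewrite [RHS](partition_big blk predT). Qed.

Lemma sum_count_mem (l : seq B) : (\sum_be count_mem be l = size l)%N.
Proof.
elim: l => [|be l IH] /=; first by rewrite big1.
rewrite big_split /= IH (bigD1 be)//= eqxx big1// => be' /negPf nb.
by rewrite eq_sym nb.
Qed.

Lemma walk_support_sum l v x : walk l (point v) x != 0 ->
  (\sum_j v j = \sum_j x j + size l)%N.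
Proof.
case/walk_support=> _ sumv; rewrite -2!blksum_sum; under eq_bigr do rewrite sumv.
by rewrite big_split /= sum_count_mem.
Qed.

(** The walk sees only finitely many vertices, and there [d] is a combination of point masses, so
    linearity applies. *)
Lemma walk_as_sum l x : exists s : seq V, uniq s /\
  forall d, walk l d x = \sum_(v <- s) d v * walk l (point v) x.
Proof.
have [S HS] : exists S : {fset V}, forall d d',
    {in S, d =1 d'} -> walk l d x = walk l d' x.
  elim: l x => [|be l IH] x.
    by exists [fset x]%fset => d d' e; apply: e; rewrite inE.
  have [S HS] := choice (fun j => IH (incr j x)).
  exists (\bigcup_(j <- enum C) S j)%fset => d d' e /=; congr (_ / _).
  apply: eq_bigr => j _; apply: HS => v vS; apply: e.
  by apply/bigfcupP; exists j; rewrite ?mem_enum.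
exists S; split=> [|d]; first exact: fset_uniq.
have w0 : walk l (fun=> 0) x = 0.
  by elim: l x {S HS} => //= be l IH x; rewrite big1 ?mul0r.
rewrite (HS d (fun y => 0 + \sum_(v <- S) d v * point v y)); last first.
  by move=> y yS; rewrite add0r sum_point ?fset_uniq// yS.
by rewrite (@walk_add_points S d (fun=> 0)) // w0 add0r.
Qed.

Lemma walk_fibre_le (V' : choiceType) (zeta : V -> V') d z c l x kap :
  (forall v, 0 <= d v) -> fibre_le zeta d z c -> 0 <= kap ->
  (forall v, walk l (point v) x <= kap) ->
  (forall v, walk l (point v) x != 0 -> zeta v = z) ->
  walk l d x <= kap * c.
Proof.
move=> d0 dz k0 wk wz; have [s [us ->]] := walk_as_sum l x.
rewrite (bigID (fun v => zeta v == z)) /= [X in _ + X]big1 ?addr0; last first.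
  move=> v; have [->|/wz ->] := eqVneq (walk l (point v) x) 0; first by rewrite mulr0.
  by rewrite eqxx.
apply: le_trans (_ : \sum_(v <- s | zeta v == z) d v * kap <= _).
  by apply: ler_sum => v _; rewrite ler_wpM2l.
rewrite -mulr_suml mulrC ler_wpM2l// -big_filter dz ?filter_uniq//.
exact: filter_all.
Qed.

End Walk.

(** * The weighted sum of expected damages *)

Section Danger.
Variables (R : realType) (C B : finType) (blk : C -> B) (m : nat) (lam : R).
Hypothesis lam_ge0 : 0 <= lam.
Local Notation V := {ffun C -> nat}.
Local Notation walk := (walk blk m).
Local Notation point := (point R).

(** Unfolds to the sum over [k] of [lam ^ (k - 1)] times the expected damage after [k] steps. The
    recursive form exposes what a first step does to it. *)
Fixpoint danger (l : seq B) (d : V -> R) (x : V) : R :=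
  if l is be :: l' then
    (\sum_(j | blk j == be) (d (incr j x) + lam * danger l' d (incr j x))) / m%:R
  else 0.

Lemma danger_ge0 l d x : (forall v, 0 <= d v) -> 0 <= danger l d x.
Proof.
move=> d0; elim: l x => [|be l IH] x //=.
by rewrite divr_ge0// sumr_ge0// => j _; rewrite addr_ge0// mulr_ge0.
Qed.

Lemma danger_rcons l be d x :
  danger (rcons l be) d x = danger l d x + lam ^+ size l * walk (rcons l be) d x.
Proof.
elim: l x => [|be' l IH] x /=.
  by rewrite expr0 mul1r add0r; under eq_bigr do rewrite mulr0 addr0.
rewrite mulrA mulr_sumr -mulrDl -big_split; congr (_ / _).
by apply: eq_bigr => j _; rewrite IH mulrDr addrA mulrA -exprS.
Qed.

Lemma danger0 l x : danger l (fun=> 0) x = 0.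
Proof.
elim: l x => [|be l IH] x //=.
by rewrite big1 ?mul0r// => j _; rewrite IH mulr0 addr0.
Qed.

Lemma danger_add_points s c d d' l x :
  (forall y, d' y = d y + \sum_(v <- s) c v * point v y) ->
  danger l d' x = danger l d x + \sum_(v <- s) c v * danger l (point v) x.
Proof.
move=> d'E; elim: l x => [|be l IH] x /=.
  by rewrite big1 ?addr0// => v _; rewrite mulr0.
under eq_bigr do rewrite IH d'E mulrDr addrACA mulr_sumr -big_split.
rewrite big_split mulrDl /=; congr (_ + _).
rewrite exchange_big mulr_suml; apply: eq_bigr => v _.
rewrite mulrA mulr_sumr; congr (_ / _).
by apply: eq_bigr => j _; rewrite mulrDr mulrCA.
Qed.

Lemma danger_turn q kap d d' l x : (forall v, danger l (point v) x <= kap) ->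
  0 <= kap -> fractional_turn q d d' ->
  danger l d' x <= danger l d x + q * kap.
Proof.
move=> dk k0 tn; have [_ [S dS sumS]] := tn.
rewrite (@danger_add_points S (fun v => d' v - d v) d d'); last first.
  by move=> y; rewrite sum_point ?fset_uniq//; case: ifPn => [_|/dS ->]; ring.
rewrite lerD2l; apply: le_trans (_ : \sum_(v <- S) (d' v - d v) * kap <= _).
  by apply: ler_sum => v _; rewrite ler_wpM2l// subr_ge0 (turn_ge v tn).
by rewrite -mulr_suml ler_wpM2r.
Qed.

(** The level of [v] fixes the number of steps needed to reach it, so at most one term of the sum is
    nonzero. *)
Lemma danger_point_le kap l v x : 0 <= kap ->
  (forall l1 l2 be, l = rcons l1 be ++ l2 ->
     lam ^+ size l1 * walk (rcons l1 be) (point v) x <= kap) ->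
  danger l (point v) x <= kap.
Proof.
move=> k0 wk.
(* The second conjunct strengthens the induction: when the last step can hit [v], the earlier ones
   contribute nothing. *)
suff [] : danger l (point v) x <= kap /\
    ((\sum_j x j + size l < \sum_j v j)%N -> danger l (point v) x = 0) by [].
elim/last_ind: l wk => [|l be IH] wk; first by split.
have [|dk d0] := IH.
  by move=> l1 l2 be' e; apply: (wk _ (rcons l2 be)); rewrite e rcons_cat.
rewrite danger_rcons size_rcons.
have [w0|nz] := eqVneq (walk (rcons l be) (point v) x) 0.
  by rewrite w0 mulr0 addr0; split=> // lt; apply: d0; lia.
have := walk_support_sum nz; rewrite size_rcons => e.
rewrite d0 ?add0r; last lia.
split; last lia.
by apply: (wk l [::]); rewrite cats0.
Qed.

End Danger.

(** * Numerical estimates *)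

Section FactorialBounds.

Lemma bernoulli_nat x k : (x ^ k * (x + k) <= x.+1 ^ k * x)%N.
Proof.
elim: k => [|k IH]; first by rewrite !expn0 addn0.
rewrite !expnS -!mulnA; apply: leq_trans (_ : x.+1 * (x ^ k * (x + k)) <= _)%N.
  by rewrite mulnCA [leqRHS]mulnCA leq_mul2l; apply/orP; right; nia.
by rewrite leq_mul2l IH orbT.
Qed.

(** The AM-GM bound for the factors 2, ..., k + 1, whose mean is (k + 3) / 2; the induction step
    follows from Bernoulli's inequality. *)
Lemma fact_amgm k : (2 ^ k * k.+1`! <= (k + 3) ^ k)%N.
Proof.
elim: k => [//|k IH]; rewrite factS !expnS.
have b := bernoulli_nat (k + 3) k.
apply: leq_trans (_ : 2 * k.+2 * (k + 3) ^ k <= _)%N.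
  by rewrite mulnACA leq_mul2l IH orbT.
have k3 : (0 < k + 3)%N by rewrite addn3.
rewrite -(leq_pmul2r k3).
apply: leq_trans (_ : (k.+1 + 3) * ((k + 3) ^ k * (k + 3 + k)) <= _)%N; last first.
  by rewrite -mulnA leq_mul2l addSn b orbT.
rewrite -mulnA mulnCA [leqRHS]mulnCA leq_mul2l; apply/orP; right; lia.
Qed.

Lemma leq_expn_base x y e : (x <= y)%N -> (x ^ e <= y ^ e)%N.
Proof. by case: e => // e; rewrite leq_exp2r. Qed.

Lemma fact_add_le n k : ((n + k)`! <= n`! * (n + k) ^ k)%N.
Proof.
elim: k => [|k IH]; first by rewrite addn0 muln1.
rewrite addnS factS expnS mulnCA leq_mul2l; apply/orP; right.
by apply: leq_trans IH _; rewrite leq_mul2l leq_expn_base ?leqnSn ?orbT.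
Qed.

End FactorialBounds.

(** * Visit probabilities within a window *)

Section Numerics.
Variables (R : realType) (b : nat) (b_gt0 : (0 < b)%N).
Local Notation lam := (6 / 5 : R).
Local Notation vb := (visit_bound R).

(** With [c = k + 1], [fact_amgm] reduces the claim to [6 (k + 3) <= 2 * 5 * 8b]. *)
Lemma visit_bound_small c : (0 < c <= 8 * b)%N ->
  lam ^+ c * vb (8 * b) c <= lam / (8 * b)%:R.
Proof.
case: c => // k /= kb.
have m0 : 0 < (8 * b)%:R :> R by rewrite ltr0n; lia.
have key : (6 ^ k * k.+1`! <= (5 * (8 * b)) ^ k)%N.
  rewrite -(leq_pmul2r (expn_gt0 2 k)).
  apply: leq_trans (_ : 6 ^ k * (k + 3) ^ k <= _)%N.
    by rewrite -mulnA [(_`! * _)%N]mulnC leq_mul2l fact_amgm orbT.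
  by rewrite -!expnMn leq_expn_base//; lia.
rewrite /visit_bound (eqP (_ : k.+1 - 8 * b == 0)%N) // expn0 muln1 natrX.
set M : R := (8 * b)%:R; have M0 : 0 < M by [].
have -> : lam ^+ k.+1 * (k.+1`!%:R / M ^+ k.+1) =
    lam / M * ((6 / (5 * M)) ^+ k * k.+1`!%:R).
  have -> : 6 / (5 * M) = lam / M by rewrite invfM mulrA.
  by rewrite [(lam / M) ^+ k]expr_div_n !exprS invfM; ring.
apply: ler_piMr; first by rewrite divr_ge0 ?ltW//; lra.
rewrite expr_div_n mulrAC ler_pdivrMr ?exprn_gt0 ?mulr_gt0// mul1r.
have : (6 ^ k * k.+1`!)%:R <= ((5 * (8 * b)) ^ k)%:R :> R by rewrite ler_nat.
by rewrite natrM !natrX [(5 * (8 * b))%:R]natrM.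
Qed.

(** Beyond [m = 8b] steps, each further step multiplies the factorial by at most [2m] and the
    denominator by exactly [2m], so the bound at [c = m] dominates. *)
Lemma visit_bound_large c : (8 * b <= c <= 16 * b)%N ->
  vb (8 * b) c <= (8 * b)`!%:R / (8 * b)%:R ^+ (8 * b).
Proof.
case/andP => mc cm.
have m0 : 0 < (8 * b)%:R :> R by rewrite ltr0n; lia.
rewrite /visit_bound ler_pdivrMr; last by rewrite ltr0n muln_gt0 !expn_gt0; lia.
rewrite mulrAC ler_pdivlMr ?exprn_gt0// -natrX -!natrM ler_nat.
have := fact_add_le (8 * b) (c - 8 * b); rewrite subnKC// => h.
apply: leq_trans (_ : (8 * b)`! * c ^ (c - 8 * b) * (8 * b) ^ (8 * b) <= _)%N.
  by rewrite leq_mul2r h orbT.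
set e := (c - 8 * b)%N in h *.
have ce : (c ^ e <= (8 * b) ^ e * 2 ^ e)%N.
  by rewrite -expnMn leq_expn_base//; lia.
rewrite -mulnA leq_mul2l; apply/orP; right.
rewrite -[in leqRHS](subnKC mc) expnD -/e mulnC -mulnA leq_mul2l.
by rewrite ce orbT.
Qed.

Lemma visit_bound_mid c : (8 * b <= c <= (12 * b).+1)%N ->
  lam ^+ c * vb (8 * b) c <= lam / (8 * b)%:R.
Proof.
case/andP => mc cb.
have b0 : 0 < b%:R :> R by rewrite ltr0n.
have M0 : 0 < (8 * b)%:R :> R by rewrite ltr0n; lia.
apply: le_trans (_ : lam ^+ (12 * b).+1 *
    ((8 * b)`!%:R / (8 * b)%:R ^+ (8 * b)) <= _).
  apply: ler_pM.
  - by apply: exprn_ge0; lra.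
  - by rewrite /visit_bound divr_ge0.
  - by apply: ler_weXn2l => //; lra.
  - by apply: visit_bound_large; lia.
have [k k8] : exists k, (8 * b = k.+1)%N by exists (8 * b).-1; lia.
(* By [fact_amgm], as (k + 3) / 2 = 4b + 1 is at most 5b. *)
have factb : (8 * b)`!%:R <= (5 * b)%:R ^+ k :> R.
  rewrite -natrX ler_nat k8.
  rewrite -(leq_pmul2r (expn_gt0 2 k)) mulnC; apply: leq_trans (fact_amgm k) _.
  by rewrite -expnMn leq_expn_base//; lia.
(* The spare factor 5/8 makes up for the exponent [k = 8b - 1] instead of [8b]. *)
have powb : (lam ^+ 12 * (5 / 8) ^+ 8) ^+ b <= 5 / 8.
  have z0 : 0 <= lam ^+ 12 * (5 / 8) ^+ 8 by lra.
  have z1 : lam ^+ 12 * (5 / 8) ^+ 8 <= 5 / 8 by lra.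
  rewrite -(prednK b_gt0) exprS; apply: le_trans z1.
  by rewrite ler_piMr// exprn_ile1//; lra.
have -> : (8 * b)%:R ^+ (8 * b) = (8 * b)%:R * (8 * b)%:R ^+ k :> R.
  by rewrite {2}k8 exprS.
rewrite exprS -mulrA ler_pM2l; last by lra.
rewrite invfM mulrA mulrA ler_pdivrMr ?exprn_gt0//.
rewrite ler_pdivrMr// mulrAC mulVf ?gt_eqF// mul1r.
apply: le_trans (_ : lam ^+ (12 * b) * (5 * b)%:R ^+ k <= _).
  by rewrite ler_wpM2l// exprn_ge0//; lra.
have -> : (5 * b)%:R ^+ k = (5 / 8) ^+ k * (8 * b)%:R ^+ k :> R.
  by rewrite -exprMn !natrM; congr (_ ^+ _); field.
rewrite mulrA ler_piMl ?exprn_ge0//.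
move: powb; rewrite exprMn -!exprM k8 [(5 / 8) ^+ k.+1]exprS; lra.
Qed.

Lemma visit_bound_le c : (0 < c <= (12 * b).+1)%N ->
  lam ^+ c * vb (8 * b) c <= lam / (8 * b)%:R.
Proof.
case/andP => c0 cb; have [cm|/ltnW mc] := leqP c (8 * b).
  by apply: visit_bound_small; rewrite c0.
by apply: visit_bound_mid; rewrite mc.
Qed.

End Numerics.

(** * Visit probabilities a full window ahead *)

Section WindowBound.
Variable R : realType.
Local Notation lam := (6 / 5 : R).
Local Notation vb := (visit_bound R).
Local Notation y b := (lam ^+ (12 * b) * vb (8 * b) (12 * b)).

Lemma windowE b : y b =
  lam ^+ (12 * b) * ((12 * b)`!%:R / ((8 * b)%:R ^+ (12 * b) * 2 ^+ (4 * b))).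
Proof.
by rewrite /visit_bound natrM !natrX (_ : 12 * b - 8 * b = 4 * b)%N //; lia.
Qed.

Lemma fact12 : 12`!%:R = 12 * 11 * 10 * 9 * 8 * 7 * 6 * 5 * 4 * 3 * 2 :> R.
Proof.
rewrite factS natrM; do 10 rewrite factS natrM mulrA.
by rewrite (_ : 1`! = 1%N) // mulr1.
Qed.

Lemma window_base : y 1 <= 1 / 250.
Proof. rewrite windowE !muln1 fact12; lra. Qed.

(** The ratio is at most (6/5)^12 (3/2)^12 / (4096 * 16), about 0.018: 3/2 is 12/8, 4096 = 2^12
    comes from (1 + 1/b)^b >= 2, and 16 from the power of 2. *)
Lemma window_step b : (0 < b)%N -> y b.+1 <= y b / 50.
Proof.
move=> b0.
have bR : 0 < b%:R :> R by rewrite ltr0n.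
have f1 : (12 * b.+1)`!%:R <= (12 * b)`!%:R * (12 * b.+1)%:R ^+ 12 :> R.
  have := fact_add_le (12 * b) 12; rewrite (_ : 12 * b + 12 = 12 * b.+1)%N; last lia.
  by rewrite -natrX -natrM ler_nat.
have f2 : 4096 * (8 * b)%:R ^+ (12 * b) <= (8 * b.+1)%:R ^+ (12 * b) :> R.
  have : (2 * b ^ b <= b.+1 ^ b)%N.
    rewrite -(leq_pmul2r b0) (leq_trans _ (bernoulli_nat b b))// -mulnA mulnCA.
    by rewrite leq_mul2l; apply/orP; right; lia.
  rewrite -(ler_nat R) natrM !natrX => h.
  rewrite !natrM !exprMn mulrCA ler_pM2l ?exprn_gt0// mulnC !exprM.
  have -> : 4096 = 2 ^+ 12 :> R by ring.
  by rewrite -exprMn ler_pXn2r// nnegrE ?mulr_ge0 ?exprn_ge0//.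
rewrite !windowE.
have -> : (12 * b.+1 = 12 + 12 * b)%N by lia.
have -> : (4 * b.+1 = 4 + 4 * b)%N by lia.
have -> : (12 + 12 * b)`! = (12 * b.+1)`! by congr (_`!); lia.
rewrite (exprD lam 12 (12 * b)) (exprD (8 * b.+1)%:R 12 (12 * b)) (exprD 2 4 (4 * b)).
have Z0 : 0 < (8 * b.+1)%:R ^+ 12 :> R by rewrite exprn_gt0// ltr0n.
have ZE : (12 * b.+1)%:R ^+ 12 = (3 / 2) ^+ 12 * (8 * b.+1)%:R ^+ 12 :> R.
  by rewrite -exprMn !natrM; congr (_ ^+ _); field.
rewrite {}ZE in f1.
have P0 : 0 < (8 * b)%:R ^+ (12 * b) :> R by rewrite exprn_gt0// ltr0n; lia.
have A0 : 0 <= lam ^+ (12 * b) by apply: exprn_ge0; lra.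
have Q0 : 0 < 2 ^+ (4 * b) :> R by apply: exprn_gt0; lra.
have F0 : 0 <= (12 * b)`!%:R :> R by [].
move: f1 f2 Z0 P0 A0 Q0 F0.
move: ((12 * b.+1)`!%:R) ((12 * b)`!%:R) ((8 * b.+1)%:R ^+ 12) => F' F Z.
move: ((8 * b)%:R ^+ (12 * b)) ((8 * b.+1)%:R ^+ (12 * b)) => P P'.
move: (lam ^+ (12 * b)) (2 ^+ (4 * b)) => A Q f1 f2 Z0 P0 A0 Q0 F0.
have P'0 : 0 < P' by apply: lt_le_trans f2; rewrite mulr_gt0.
have -> : lam ^+ 12 * A * (F' / (Z * P' * (2 ^+ 4 * Q))) =
    A / Q * (F' / (Z * P')) * (lam ^+ 12 / 16).
  by field; rewrite !gt_eqF.
have -> : A * (F / (P * Q)) / 50 = A / Q * (F / (P * 50)).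
  by field; rewrite !gt_eqF.
rewrite -mulrA; apply: ler_wpM2l; first by rewrite divr_ge0 // ltW.
have : F' / (Z * P') <= (3 / 2) ^+ 12 / 4096 * (F / P).
  rewrite ler_pdivrMr ?mulr_gt0//; apply: le_trans f1 _.
  have -> : F * ((3 / 2) ^+ 12 * Z) = (3 / 2) ^+ 12 / 4096 * (F / P) * (Z * (4096 * P)).
    by field; rewrite gt_eqF.
  apply: ler_wpM2l; last by rewrite ler_pM2l.
  by apply: mulr_ge0; [lra | rewrite divr_ge0 // ltW].
have -> : F / (P * 50) = F / P / 50 by field; rewrite gt_eqF.
have : 0 <= F / P by rewrite divr_ge0 // ltW.
lra.
Qed.

Lemma window_decay b : (0 < b)%N -> y b <= 1 / (250 * b%:R).
Proof.
case: b => // b _; elim: b => [|b IH]; first by rewrite mulr1 window_base.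
apply: le_trans (window_step (ltn0Sn b)) _.
have b0 : 1 <= b.+1%:R :> R by rewrite ler1n.
have -> : b.+2%:R = b.+1%:R + 1 :> R by rewrite -[in LHS]addn1 natrD.
have y0 : 0 <= y b.+1.
  by apply: mulr_ge0; [apply: exprn_ge0; lra | rewrite /visit_bound divr_ge0].
move: IH b0 y0; move: (y b.+1) (b.+1%:R : R) => z x IH x1 z0.
rewrite ler_pdivlMr in IH; last lra.
rewrite ler_pdivlMr; last lra.
have : z <= z * x by rewrite ler_peMr.
lra.
Qed.

(** Bounds the weighted expected damage [36b + 1] steps ahead, in a region of total damage
    [K b (36b + 1)]. As [b >= 1], it is at most [37 K (b y)^3], where [b y <= 1/250] by
    [window_decay]. *)
Lemma window_bound K b : 0 <= K <= 10 ^+ 4 -> (0 < b)%N ->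
  lam ^+ (36 * b) * (vb (8 * b) (12 * b) ^+ 2 * vb (8 * b) (12 * b).+1) *
    (K * b%:R * (36 * b%:R + 1)) <= 1 / 25.
Proof.
move=> /andP[K0 K4] b0; have b1 : 1 <= b%:R :> R by rewrite ler1n.
have v0 c : 0 <= vb (8 * b) c by rewrite /visit_bound divr_ge0.
have vS : vb (8 * b) (12 * b).+1 <= vb (8 * b) (12 * b).
  rewrite /visit_bound factS (_ : (12 * b).+1 - 8 * b = (12 * b - 8 * b).+1)%N; last lia.
  rewrite !expnS mulnACA natrM [X in _ / X]natrM invfM mulrACA ler_piMl ?divr_ge0//.
  by rewrite ler_pdivrMr ?mul1r ?ler_nat ?ltr0n; lia.
have l0 : 0 <= lam ^+ (12 * b) by apply: exprn_ge0; lra.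
have -> : lam ^+ (36 * b) = lam ^+ (12 * b) ^+ 3.
  by rewrite -exprM; congr (_ ^+ _); lia.
apply: le_trans (_ : y b ^+ 3 * (K * b%:R * (36 * b%:R + 1)) <= _).
  rewrite ler_wpM2r ?mulr_ge0 ?addr_ge0 ?mulr_ge0//.
  rewrite [y b ^+ 3]exprMn; apply: ler_wpM2l; first by rewrite exprn_ge0.
  by rewrite (exprSr _ 2); apply: ler_wpM2l; first by rewrite exprn_ge0.
have y0 : 0 <= y b by rewrite mulr_ge0.
have := window_decay b0; move: (y b) y0 (b%:R : R) b1 => z z0 x x1.
rewrite ler_pdivlMr; last by lra.
move=> zx.
have w0 : 0 <= x * z by apply: mulr_ge0 => //; lra.
have zx2 : (x * z) ^+ 3 <= (1 / 250) ^+ 3.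
  by rewrite lerXn2r ?nnegrE//; lra.
have : z ^+ 3 * (K * x * (36 * x + 1)) <= (x * z) ^+ 3 * (K * 37).
  have -> : (x * z) ^+ 3 * (K * 37) = z ^+ 3 * (K * 37 * x ^+ 3) by ring.
  rewrite ler_wpM2l ?exprn_ge0//.
  have -> : K * 37 * x ^+ 3 = K * x * (37 * x ^+ 2) by ring.
  rewrite ler_wpM2l ?mulr_ge0//; first by lra.
  nra.
move=> A; apply: le_trans A _.
apply: le_trans (_ : (1 / 250) ^+ 3 * (10 ^+ 4 * 37) <= _); last by lra.
apply: ler_pM => //; first by rewrite exprn_ge0.
  by apply: mulr_ge0 => //; lra.
by apply: ler_wpM2r => //; lra.
Qed.

End WindowBound.

(** * From W^(24b) to W^3 *)

Section WedgeGame.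
Variables (R : realType) (b : nat) (b_gt0 : (0 < b)%N).
Local Notation C := 'I_(24 * b).
Local Notation V := {ffun C -> nat}.
Local Notation lam := (6 / 5 : R).
Let N := (36 * b).+1.
(** [M] is the round length of the lattice game for [t = 200], so that game has power [p]. [D] is
    chosen so that [N] turns of power [b] make one lattice turn of power [b N / D = p]. *)
Let M : R := (7 * 200).+1%:R.
Let p : R := (5 * M)^-1.
Let D : R := b%:R * N%:R * (5 * M).

Lemma block_proof (j : C) : (j %/ (8 * b) < 3)%N.
Proof. by rewrite ltn_divLR; have := ltn_ord j; lia. Qed.

Definition block (j : C) : 'I_3 := Ordinal (block_proof j).

Lemma card_block be : #|[pred j | block j == be]| = (8 * b)%N.
Proof.
have bd (k : 'I_(8 * b)) : (be * (8 * b) + k < 24 * b)%N.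
  have : (be * (8 * b) <= 2 * (8 * b))%N by rewrite leq_mul2r -ltnS ltn_ord orbT.
  by have := ltn_ord k; lia.
pose f k : C := Ordinal (bd k).
rewrite -[RHS]card_ord -(card_codom (f := f)); last first.
  by move=> k k' [] /addnI /val_inj.
apply: eq_card => j; rewrite !inE; apply/eqP/codomP => [bj|[k ->]].
  have lt : (j %% (8 * b) < 8 * b)%N by rewrite ltn_mod; lia.
  by exists (Ordinal lt); apply: val_inj; rewrite /= -bj /= -divn_eq.
by apply: val_inj; rewrite /= divnMDl ?divn_small ?addn0//; lia.
Qed.

Let b1 : 'I_3 := inord 1.
Let b2 : 'I_3 := inord 2.

Lemma eq_b1 i : (i == b1) = (i == 1%N :> nat).
Proof. by rewrite -val_eqE /= inordK. Qed.

Lemma eq_b2 i : (i == b2) = (i == 2%N :> nat).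
Proof. by rewrite -val_eqE /= inordK. Qed.

Definition circuit : seq 'I_3 :=
  nseq (12 * b) ord0 ++ nseq (12 * b) b1 ++ nseq (12 * b) b2.

Lemma count_circuit be : count_mem be circuit = (12 * b)%N.
Proof.
rewrite /circuit !count_cat !count_nseq /=.
rewrite -!val_eqE /= /b1 /b2 !inordK//.
by case: be => [[|[|[|//]]]] ? /=; lia.
Qed.

Lemma size_circuit : size circuit = (36 * b)%N.
Proof. by rewrite !size_cat !size_nseq; lia. Qed.

(** [x] is [s] steps into round [z.1.1] (counted from 0), and [z.1.2], [z.2] count the selected
    steps in blocks [b1], [b2]. The remaining block is determined by the total. *)
Definition stationed (z : site) (s : nat) (x : V) : Prop :=
  [/\ (\sum_j x j = N * z.1.1 + s)%N,
      blksum block b1 x = (12 * b * z.1.1 + z.1.2 + count_mem b1 (take s circuit))%N &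
      blksum block b2 x = (12 * b * z.1.1 + z.2 + count_mem b2 (take s circuit))%N].

Definition station (x : V) : site :=
  let m := ((\sum_j x j) %/ N)%N in
  let l := take ((\sum_j x j) %% N) circuit in
  (m, blksum block b1 x - 12 * b * m - count_mem b1 l,
   blksum block b2 x - 12 * b * m - count_mem b2 l)%N.

Lemma stationedP z s x : (s < N)%N -> stationed z s x -> station x = z.
Proof.
case: z => [[m z1] z2] sN [/= e0 e1 e2]; rewrite /station.
have [|-> ->] := @divmod_unique (\sum_j x j) m s N isT _ sN; first by rewrite e0 mulnC.
by rewrite e1 e2 -!addnA !addKn !addnK.
Qed.

(** The next [N] steps from phase [s] of a round with selected block [i]: the rest of the round,
    then the first [s] steps of the next. At phase 0 all but the last step are known before [i] is,
    and a full window always leads to phase [s] of the next region. *)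
Definition window (i : 'I_3) (s : nat) : seq 'I_3 := rot s (rcons circuit i).

Lemma count_window be i s : count_mem be (window i s) = (12 * b + (i == be))%N.
Proof.
rewrite (permP (_ : perm_eq _ (rcons circuit i))) ?perm_rot//.
by rewrite -cats1 count_cat count_circuit /= addn0.
Qed.

Lemma size_window i s : size (window i s) = N.
Proof. by rewrite size_rot size_rcons size_circuit. Qed.

Lemma stationed_window z s x v i : stationed z s x ->
  walk block (8 * b) (window i s) (point R v) x != 0 ->
  stationed (site_move i z) s v.
Proof.
case: z => [[m z1] z2] [/= e0 e1 e2] nz; have e := walk_support_sum nz.
have [_ sumv] := walk_support nz.
split => /=; first by rewrite e e0 size_window mulnS; lia.
  by rewrite sumv e1 count_window mulnS eq_b1; lia.
by rewrite sumv e2 count_window mulnS eq_b2; lia.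
Qed.

Lemma window_head i s be l : (s < N)%N -> window i s = be :: l ->
  be = nth ord0 (rcons circuit i) s /\ window i s.+1 = rcons l be.
Proof.
move=> sN w; have sc : (s < size (rcons circuit i))%N.
  by rewrite size_rcons size_circuit.
split; last by rewrite -[RHS]rot1_cons -w /window -rotS.
by move: w; rewrite /window /rot (drop_nth ord0 sc) => -[].
Qed.

Lemma stationed_step z s x j i l : (s < N)%N ->
  window i s = block j :: l -> stationed z s x ->
  if (s < 36 * b)%N then stationed z s.+1 (incr j x)
  else stationed (site_move i z) 0 (incr j x).
Proof.
move=> sN /(window_head sN)[blkE _].
have sumi : (\sum_k incr j x k = (\sum_k x k).+1)%N.
  rewrite (eq_bigr (fun k => x k + (k == j))%N); last by move=> k _; rewrite ffunE.
  rewrite big_split /= -[RHS]addn1; congr (_ + _)%N.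
  by rewrite (bigD1 j)//= eqxx big1// => k /negPf->.
have blki be : blksum block be (incr j x) = (blksum block be x + (block j == be))%N.
  rewrite /blksum (eq_bigr (fun k => x k + (k == j))%N); last first.
    by move=> k _; rewrite ffunE.
  rewrite big_split /=; congr (_ + _)%N; case: eqP => [<-|nb].
    by rewrite (bigD1 j) //= eqxx big1 // => k /andP[_ /negPf ->].
  by rewrite big1 // => k; case: (k =P j) => // -> /eqP /nb.
case: z => [[m z1] z2] [/= e0 e1 e2]; case: ifPn => s36.
  have sc : (s < size circuit)%N by rewrite size_circuit.
  rewrite nth_rcons sc in blkE.
  by split=> /=; rewrite ?sumi ?blki ?e0 ?e1 ?e2 ?(take_nth ord0 sc) -?blkE
    -?cats1 ?count_cat /=; lia.
have sE : s = (36 * b)%N by lia.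
rewrite nth_rcons size_circuit sE ltnn eqxx in blkE.
have tc : take s circuit = circuit by rewrite take_oversize// size_circuit sE.
split=> /=; rewrite ?sumi ?blki ?e0 ?e1 ?e2 ?blkE ?tc ?count_circuit ?take0 /=
  ?mulnS ?eq_b1 ?eq_b2; lia.
Qed.

(** * Keeping the danger bounded throughout a round *)

Local Notation vb := (visit_bound R).

Let m_gt0 : (0 < 8 * b)%N. Proof. lia. Qed.

Let lam_ge0 : 0 <= lam. Proof. lra. Qed.

(** One more factor [lam] lets the powers be distributed over the blocks. The block [be] occurs,
    hence contributes at most [lam / (8b)]; every other block contributes at most 1. *)
Lemma visit_weight (l : seq 'I_3) be :
  (forall be', (count_mem be' (be :: l) <= (12 * b).+1)%N) ->
  lam ^+ size l * \prod_be' vb (8 * b) (count_mem be' (be :: l)) <=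
  (8 * b)%:R^-1.
Proof.
move=> cl; have lam0 : 0 < lam by lra.
have lv0 c : 0 <= lam ^+ c * vb (8 * b) c.
  by rewrite mulr_ge0 ?exprn_ge0 ?(ltW lam0)// /visit_bound divr_ge0.
rewrite -(ler_pM2l lam0) mulrA -exprS -[(size l).+1]/(size (be :: l)).
rewrite -(sum_count_mem (be :: l)) -prodrXr -big_split /=.
rewrite (bigD1 be) //= eqxx -[leRHS]mulr1; apply: ler_pM.
- exact: (lv0 (1 + _)%N).
- by apply: prodr_ge0 => i _; exact: lv0.
- by apply: visit_bound_le => //; have := cl be; rewrite /= eqxx.
apply: prodr_ile1 => i _; rewrite lv0 /=.
have := cl i; rewrite /=; case: ((be == i) + count_mem i l)%N => [|c] cb.
  by rewrite mul1r /visit_bound sub0n divr1.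
apply: le_trans (visit_bound_le R b_gt0 (_ : 0 < c.+1 <= _)%N) _ => //.
rewrite ler_pdivrMr ?ltr0n// mul1r; apply: le_trans (_ : 8%:R <= _); first lra.
by rewrite ler_nat; lia.
Qed.

Local Notation dangerW := (danger (block : C -> 'I_3) (8 * b) lam).

Lemma danger_devil l d d' x :
  (forall be, (count_mem be l <= (12 * b).+1)%N) ->
  fractional_turn b%:R d d' -> dangerW l d' x <= dangerW l d x + 1 / 8.
Proof.
move=> cl tn; have -> : 1 / 8 = b%:R * (8 * b)%:R^-1 :> R.
  by rewrite natrM; field; rewrite pnatr_eq0; lia.
have m0 : 0 <= (8 * b)%:R^-1 :> R by rewrite invr_ge0.
apply: (danger_turn _ m0 tn) => v; apply: danger_point_le => // l1 l2 be lE.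
have cl1 be' : (count_mem be' (be :: l1) <= (12 * b).+1)%N.
  by have := cl be'; rewrite lE count_cat -cats1 count_cat /= addn0 addnC; lia.
apply: le_trans (visit_weight cl1).
rewrite ler_wpM2l ?exprn_ge0//.
apply: le_trans (walk_point_le R m_gt0 card_block _ _ _) _.
rewrite le_eqVlt; apply/orP; left; apply/eqP; apply: eq_bigr => be' _.
by rewrite -cats1 count_cat /= addn0 addnC.
Qed.

(** The walk along a full window ends in the next region, whose damage is bounded, and hits each
    vertex there with tiny probability. *)
Lemma window_walk_le z s x i d : (s < N)%N -> (forall v, 0 <= d v) ->
  stationed z s x ->
  fibre_le station d (site_move i z) (D + b%:R * N%:R) ->
  lam ^+ (36 * b) * walk block (8 * b) (window i s) d x <= 1 / 25.
Proof.
move=> sN d0 st dz.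
have v0 c : 0 <= vb (8 * b) c by rewrite /visit_bound divr_ge0.
have bound := walk_fibre_le d0 dz _ _ _ (l := window i s) (x := x)
  (kap := vb (8 * b) (12 * b) ^+ 2 * vb (8 * b) (12 * b).+1).
apply: le_trans (window_bound (K := 5 * M + 1) (b := b) _ _) => //; last first.
  by rewrite /M; lra.
rewrite -mulrA ler_wpM2l ?exprn_ge0//.
(* The region damage in the form of [window_bound], with [K = 5M + 1 = 7006]. *)
have -> : (5 * M + 1) * b%:R * (36 * b%:R + 1) = D + b%:R * N%:R.
  have NE : N%:R = 36 * b%:R + 1 :> R by rewrite /N -addn1 natrD natrM.
  by rewrite /D NE; ring.
apply: bound.
- by rewrite mulr_ge0 ?exprn_ge0.
- move=> v; apply: le_trans (walk_point_le R m_gt0 card_block _ _ _) _.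
  rewrite (eq_bigr _ (fun be _ => congr1 _ (count_window be i s))).
  rewrite (bigD1 i) //= eqxx addn1 mulrC.
  rewrite (eq_bigr (fun=> vb (8 * b) (12 * b))) => [|be /negPf nb]; last first.
    by rewrite eq_sym nb addn0.
  by rewrite prodr_const cardC1 card_ord.
by move=> v nz; apply: (stationedP sN); apply: stationed_window nz.
Qed.

(* Fixed by gam = (gam + 1/25) / (6/5) + 1/8. *)
Let gam : R := 19 / 20.

(** With the newly visible step the danger is at most 19/20 + 1/25 = 99/100. Some coordinate of the
    block does no worse than average, so its vertex is open and the remaining danger is at most 5/6
    of 99/100; Devil then adds 1/8. *)
Lemma patrol_step z s x i l be d : (s < N)%N -> (forall v, 0 <= d v) ->
  stationed z s x -> fibre_le station d (site_move i z) (D + b%:R * N%:R) ->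
  window i s = rcons l be -> dangerW l d x <= gam ->
  exists j l', [/\ window i s = block j :: l', d (incr j x) < 1 &
    forall d', fractional_turn b%:R d d' -> dangerW l' d' (incr j x) <= gam].
Proof.
move=> sN d0 st dz wE dl; have tiny := window_walk_le sN d0 st dz.
have sl : size l = (36 * b)%N by have := size_window i s; rewrite wE size_rcons => -[].
have wd : dangerW (window i s) d x <= 99 / 100.
  by rewrite wE danger_rcons -wE sl; move: dl tiny; rewrite /gam; lra.
have [be' [l' w'E]] : exists be' l', window i s = be' :: l'.
  by have := size_window i s; case: (window i s) => // u v; exists u, v.
have m0 : 0 < (8 * b)%:R :> R by rewrite ltr0n.
rewrite w'E /= ler_pdivrMr// in wd.
have [||j bj dj] := @exists_le_mean _ _ [pred j | block j == be']
  (fun j => d (incr j x) + lam * dangerW l' d (incr j x)) (99 / 100).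
- by rewrite card_block.
- by rewrite card_block -[leRHS]mulr_natr; exact: wd.
have lam0 : 0 <= lam by lra.
have dl0 := danger_ge0 block (8 * b) lam0 l' (incr j x) d0.
have dj0 := d0 (incr j x).
exists j, l'; rewrite w'E (eqP bj); split=> // [|d' tn]; first by lra.
apply: le_trans (danger_devil _ _ tn) _; last by rewrite /gam; lra.
move=> be''; have := count_window be'' i s; rewrite w'E /= => cw.
apply: (@leq_trans ((be' == be'') + count_mem be'' l')); first exact: leq_addl.
by rewrite cw -[(12 * b).+1]addn1 leq_add2l leq_b1.
Qed.

(** Plays a round from phase [s] to its end. The next region has damage at most [D] when the round
    starts, and gains at most [b N] during it. *)
Lemma patrol z i T d0 : fibre_le station d0 (site_move i z) D ->
  (forall d x, fractional_turn (b%:R * N%:R) d0 d -> stationed (site_move i z) 0 x ->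
     dangerW circuit d x <= gam -> survives (@incr C) b%:R T x d) ->
  (forall v, 0 <= d0 v) ->
  forall k s d x l be, (s + k.+1 = N)%N -> window i s = rcons l be ->
  fractional_turn (b%:R * s%:R) d0 d -> stationed z s x -> dangerW l d x <= gam ->
  survives (@incr C) b%:R (k.+1 + T) x d.
Proof.
move=> dz end_ok d00; elim=> [|k IH] s d x l be sk wE tn st dl.
all: have sN : (s < N)%N by lia.
all: have d_ge0 v : 0 <= d v by exact: le_trans (d00 v) (turn_ge v tn).
all: have dz' : fibre_le station d (site_move i z) (D + b%:R * N%:R)
  by move=> q uq qz; apply: le_trans (fibre_le_turn dz tn uq qz) _;
     rewrite lerD2l ler_wpM2l// ler_nat; lia.
all: have [j [l' [w'E dj1 dj]]] := patrol_step sN d_ge0 st dz' wE dl.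
all: have := stationed_step sN w'E st.
  rewrite ifF => [st'|]; last by rewrite /N in sk; lia.
  exists j => // d' tn'; apply: end_ok => //.
    have <- : b%:R * s%:R + b%:R = b%:R * N%:R :> R.
      by rewrite -sk addn1 -natr1; ring.
    exact: turn_trans tn tn'.
  (* The last window of a round is [i] followed by [circuit], so what is left is exactly the part of
     the next round known before its own selection. *)
  suff -> : circuit = l' by exact: dj.
  move: w'E; have -> : s = size circuit by rewrite size_circuit; rewrite /N in sk; lia.
  by rewrite /window -cats1 rot_size_cat => -[].
rewrite ifT => [st'|]; last by rewrite /N in sk; lia.
exists j => // d' tn'; apply: (IH s.+1 _ _ l' (block j)) => //.
- by rewrite -sk addSnnS.
- by have [_] := window_head sN w'E.
- have <- : b%:R * s%:R + b%:R = b%:R * s.+1%:R :> R by rewrite -natr1; ring.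
  exact: turn_trans tn tn'.
exact: dj.
Qed.

(** The lattice strategy selects [i] at phase 0, when the danger along [circuit], which is
    independent of [i], is already under control. *)
Lemma wedge_simulation T z dh d x :
  survives site_move p T z dh -> (forall z, dh z <= 1) ->
  (forall v, 0 <= d v <= 1) -> charged station D d dh ->
  stationed z 0 x -> dangerW circuit d x <= gam ->
  survives (@incr C) b%:R (N * T) x d.
Proof.
have M0 : 0 < M by rewrite ltr0n.
have B0 : 0 < b%:R :> R by rewrite ltr0n.
have N0 : 0 < N%:R :> R by rewrite ltr0n.
have D0 : 0 < D by rewrite !mulr_gt0.
elim: T z dh d x => [|T IH] z dh d x; first by rewrite muln0.
move=> [i dhi surv] dh1 d01 chd st dl.
have d_ge0 v : 0 <= d v by case/andP: (d01 v).
rewrite mulnS; apply: (@patrol z i (N * T) d _ _ d_ge0 (36 * b) 0 d x circuit i) => //.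
- move=> s us sz; apply: le_trans (chd _ dhi s us sz) _.
  by rewrite ler_piMr ?ltW.
- move=> d' x' tn st' dl'.
  have [dh' tnh chd'] := charged_turn D0 dh1 chd tn.
  have tnp : fractional_turn p dh dh'.
    rewrite (_ : p = b%:R * N%:R / D) // /D /p; field.
    by rewrite !gt_eqF.
  apply: (IH _ dh') => //.
  - exact: surv.
  - by move=> z'; apply: turn_le1 tnh.
  - by move=> v; rewrite (turn_le1 v tn) (le_trans (d_ge0 v) (turn_ge v tn)).
  - exact: st'.
- exact: rot0.
- by rewrite mulr0; apply: turn_refl => v; case/andP: (d01 v).
Qed.

Lemma wedge_survives T : survives (@incr C) (b%:R : R) T [ffun=> 0%N] (fun=> 0).
Proof.
apply: (@survives_leq _ _ _ _ _ _ (N * T)); first by rewrite leq_pmull.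
have M0 : 0 < M by rewrite ltr0n.
apply: (@wedge_simulation T (0, 0, 0)%N (fun=> 0)) => //.
- apply: lattice_survives => //.
  (* 201^2 = 40401 exceeds 24 (1401 + 1/5). *)
  by rewrite card_prod card_ord natrM; lra.
- by move=> v; rewrite lexx ler01.
- by move=> z _ s _ _; rewrite big1 ?mulr0.
- by split; rewrite /= ?take0 /blksum big1 ?muln0// => j _; rewrite ffunE.
by rewrite danger0 /gam; lra.
Qed.

End WedgeGame.

(** * Strategies *)

Section Strategy.
Variables (R : realType) (G : rootedDigraph) (I : finType).
Variables (mv : I -> vertex G -> vertex G) (p : R).
Hypothesis mv_edge : forall i x, edge x (mv i x).

(** Angel always takes a move after which every horizon remains survivable; folding this rule over
    the boards seen gives the strategy. *)
Lemma survives_angel_wins :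
  (forall T, survives mv p T (Defs.root G) (fun=> 0)) -> angel_wins_fractional p G.
Proof.
move=> surv.
pose good i x d := d (mv i x) < 1 /\
  forall d', fractional_turn p d d' -> forall T, survives mv p T (mv i x) d'.
(* Staying at [x] is a junk default; the invariant [alive] guarantees a good move. *)
pose next x d := if [pick i | `[< good i x d >]] is Some i then mv i x else x.
have nextP x d : (forall T, survives mv p T x d) ->
    exists2 i, next x d = mv i x & good i x d.
  move=> /survives_forever[i gi]; rewrite /next.
  by case: pickP => [j /asboolP|/(_ i)/asboolP//]; exists j.
exists (foldl next (Defs.root G)) => B [B0 turnB].
have posE k : angel_pos (D := fractional_rules (vertex G) p)
    (foldl next (Defs.root G)) B k = foldl next (Defs.root G) (mkseq B k) by case: k.
have stepE k : foldl next (Defs.root G) (mkseq B k.+1) =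
    next (foldl next (Defs.root G) (mkseq B k)) (B k).
  by rewrite /mkseq -addn1 iotaD map_cat foldl_cat.
have alive k T : survives mv p T (foldl next (Defs.root G) (mkseq B k)) (B k).
  elim: k T => [|k IH] T; first by rewrite B0; apply: surv.
  rewrite stepE; have [i -> [_]] := nextP _ _ IH.
  by move/(_ _ (turnB k)).
move=> k; rewrite !posE stepE; have [i -> [di _]] := nextP _ _ (alive k).
by split; [exact: mv_edge | exact: di].
Qed.

End Strategy.

(** Angel treats burned vertices as having damage 1; burning at most [b] vertices is then a
    fractional turn of power [b]. *)
Lemma fractional_wins_biased (R : realType) (b : nat) (G : rootedDigraph) :
  angel_wins_fractional (b%:R : R) G -> angel_wins_biased b G.
Proof.
move=> [sigma win].
pose burnt (B : {fset vertex G}) : vertex G -> R := fun v => (v \in B)%:R.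
exists (fun h => sigma (map burnt h)) => B [B0 turnB] k.
have posE m : angel_pos (D := biased_rules (vertex G) b)
    (fun h => sigma (map burnt h)) B m =
    angel_pos (D := fractional_rules (vertex G) (b%:R : R)) sigma (burnt \o B) m.
  by case: m => //= m; rewrite /mkseq -map_comp.
have [|edge_ok free] := win (burnt \o B) _ k; last first.
  rewrite !posE; split=> //; apply: contraTN free => /= vB.
  by rewrite /burnt vB ltxx.
split=> [|m] /=; first by rewrite B0; apply: funext => v; rewrite /burnt inE.
have [sub card] := turnB m.
split=> [v|].
  rewrite /burnt /= ler_nat lern1 leq_b1 andbT.
  by case: (boolP (v \in B m)) => [/(fsubsetP sub)->|].
exists (B m.+1 `\` B m)%fset => [v|].
  rewrite inE negb_and negbK /burnt => /orP[vB|vB'].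
    by rewrite vB (fsubsetP sub).
  rewrite (negPf vB'); case: (boolP (v \in B m)) => // /(fsubsetP sub).
  by rewrite (negPf vB').
apply: le_trans (_ : \sum_(v <- (B m.+1 `\` B m)%fset) 1 <= _).
  apply: ler_sum => v _; rewrite /burnt /= lerBlDr.
  by apply: le_trans (_ : 1 <= _); rewrite ?lern1 ?leq_b1// lerDl.
by rewrite big_const_seq count_predT iter_addr addr0 ler_nat.
Qed.

Theorem theorem16 (R : realType) (b : nat) (hb : (0 < b)%N) :
  angel_wins_fractional (b%:R : R)%R (wedge (24 * b)) /\
  angel_wins_biased b (wedge (24 * b)).
Proof.
have win : angel_wins_fractional (b%:R : R) (wedge (24 * b)).
  apply: (@survives_angel_wins R (wedge (24 * b)) _ (@incr 'I_(24 * b))).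
    by move=> i x /=; apply/existsP; exists i.
  by move=> T; apply: wedge_survives.
by split=> //; apply: fractional_wins_biased win.
Qed.
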